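(* Let $R$ be a ring which is coherent from either side (left and right coherent) and has finite left pure global dimension, and let $M$ be an $R$-bimodule which is finitely presented both as a left and as a right $R$-module. Then $\mathsf{K}(\mathsf{Add}(\mathsf{sub}(\mathsf{add}({}_RM))))$ is compactly generated.
   Context: Modules are left $R$-modules unless otherwise specified; ${}_RM$ is $M$ viewed as a left module. $\mathsf{mod}\,R$ is the class of finitely presented modules. For a class (or single module) $\mathbb{A}$, $\mathsf{Add}\,\mathbb{A}$ is the class of modules isomorphic to a direct summand of a coproduct $\coprod_{i\in I}A_i$ with $A_i\in\mathbb{A}$, $I$ an arbitrary set; $\mathsf{add}\,\mathbb{A}$ is defined in the same way but with $I$ finite; and $\mathsf{sub}\,\mathbb{A}=\{S\in\mathsf{mod}\,R\mid S\subseteq A\text{ for some }A\in\mathbb{A}\}$. For a class $\mathbb{X}=\mathsf{Add}\,\mathbb{X}$, $\mathsf{K}(\mathbb{X})$ is the triangulated category with objects the ($\mathbb{Z}$-indexed) chain complexes of modules from $\mathbb{X}$ and morphisms the chain maps modulo homotopy. A triangulated category $\mathsf{T}$ with set-indexed coproducts is compactly generated if there is a set $\mathcal{G}$ of compact objects (objects $C$ for which $\coprod_i\operatorname{Hom}_{\mathsf T}(C,X_i)\to\operatorname{Hom}_{\mathsf T}(C,\coprod_iX_i)$ is always an isomorphism) such that, for all $X\in\mathsf{T}$, $\operatorname{Hom}_{\mathsf T}(G,X)=0$ for all $G\in\mathcal{G}$ implies $X\cong0$. A sequence $Y$ of modules is pure exact if $\operatorname{Hom}_R(N,Y)$ is exact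 for every finitely presented module $N$. A module $P$ is pure projective if $\operatorname{Hom}_R(P,-)$ preserves exactness of pure exact sequences. The left pure global dimension of $R$ is the least $d$ (or $\infty$) such that every left module $N$ has a pure exact sequence $0\to P_d\to\cdots\to P_0\to N\to0$ with all $P_i$ pure projective. *)

(* Defs.v *)
From HB Require Import structures.
From mathcomp Require Import all_boot all_order all_algebra.
From mathcomp Require Import generic_quotient.
From mathcomp Require Import boolp classical_sets functions cardinality fsbigop.

Set Implicit Arguments.
Unset Strict Implicit.
Unset Printing Implicit Defensive.

Import GRing.Theory.
Local Open Scope classical_set_scope.
Local Open Scope ring_scope.
Local Open Scope quotient_scope.

(* Index sets of coproducts are [choiceType]s: classically every type carries
   such a structure ([{classic T}]).  Since the direct sum below is a module
   for every [I : choiceType], the universe of [choiceType] is that of the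
   carriers of modules; in particular a family indexed by a [choiceType] is
   indexed by a set, and the (large) type of all modules or of all complexes
   cannot serve as an index. *)

Section DirectSum.
Variables (I : choiceType) (A : I -> zmodType).

Record dsum := DSum {
  dsum_val :> forall i, A i;
  dsum_fin : finite_set [set i | dsum_val i != 0] }.

HB.instance Definition _ := gen_eqMixin dsum.
HB.instance Definition _ := gen_choiceMixin dsum.

Lemma dsumP (f g : dsum) : (forall i, f i = g i) -> f = g.
Proof.
case: f g => [f hf] [g hg] /= fg.
have {}fg : f = g by apply: functional_extensionality_dep.
by rewrite -fg in hg *; congr DSum; exact: Prop_irrelevance.
Qed.

Fact dsum0_fin : finite_set [set i | (0 : A i) != 0].
Proof.
by apply: (sub_finite_set _ (finite_set0 I)) => i /=; rewrite eqxx.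
Qed.
Definition dsum0 := DSum dsum0_fin.

Fact dsumN_fin (f : dsum) : finite_set [set i | - f i != 0].
Proof.
by apply: (sub_finite_set _ (dsum_fin f)) => i /=; rewrite oppr_eq0.
Qed.
Definition dsumN f := DSum (dsumN_fin f).

Fact dsumD_fin (f g : dsum) : finite_set [set i | f i + g i != 0].
Proof.
have fin : finite_set ([set i | f i != 0] `|` [set i | g i != 0]).
  by rewrite finite_setU; split; exact: dsum_fin.
apply: (sub_finite_set _ fin) => i /= fg; apply/orP; move: fg.
by apply: contraNT; rewrite negb_or !negbK => /andP[/eqP-> /eqP->]; rewrite addr0.
Qed.
Definition dsumD f g := DSum (dsumD_fin f g).

Fact dsumDA : associative dsumD.
Proof. by move=> f g h; apply: dsumP => i; exact: addrA. Qed.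
Fact dsumDC : commutative dsumD.
Proof. by move=> f g; apply: dsumP => i; exact: addrC. Qed.
Fact dsum0D : left_id dsum0 dsumD.
Proof. by move=> f; apply: dsumP => i; exact: add0r. Qed.
Fact dsumND : left_inverse dsum0 dsumN dsumD.
Proof. by move=> f; apply: dsumP => i; exact: addNr. Qed.
HB.instance Definition _ :=
  GRing.isZmodule.Build dsum dsumDA dsumDC dsum0D dsumND.

End DirectSum.

Section DirectSumModule.
Variables (R : pzRingType) (I : choiceType) (A : I -> lmodType R).
Local Notation D := (dsum (fun i => A i : zmodType)).

Fact dsumZ_fin (a : R) (f : D) : finite_set [set i | a *: f i != 0].
Proof.
apply: (sub_finite_set _ (dsum_fin f)) => i /=.
by apply: contra_neq => ->; rewrite scaler0.
Qed.
Definition dsumZ (a : R) (f : D) : D := DSum (dsumZ_fin a f).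

Fact dsumZA a b (f : D) : dsumZ a (dsumZ b f) = dsumZ (a * b) f.
Proof. by apply: dsumP => i; exact: scalerA. Qed.
Fact dsum1Z : left_id 1 dsumZ.
Proof. by move=> f; apply: dsumP => i; exact: scale1r. Qed.
Fact dsumZDr : right_distributive dsumZ +%R.
Proof. by move=> a f g; apply: dsumP => i; exact: scalerDr. Qed.
Fact dsumZDl (f : D) : {morph dsumZ^~ f : a b / a + b}.
Proof. by move=> a b; apply: dsumP => i; exact: scalerDl. Qed.
HB.instance Definition _ :=
  GRing.Zmodule_isLmodule.Build R D dsumZA dsum1Z dsumZDr dsumZDl.

End DirectSumModule.

Definition coprod (R : pzRingType) (I : choiceType) (A : I -> lmodType R) :
  lmodType R := dsum (fun i => A i : zmodType).

Section Modules.
Variable R : pzRingType.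
Implicit Types (M N P S X : lmodType R) (A : lmodType R -> Prop).

Definition lmod_iso M N := exists f : {linear M -> N}, bijective f.

Definition finitely_generated M :=
  exists (n : nat) (g : {linear 'rV[R]_n -> M}), forall x, exists v, g v = x.

Definition finitely_presented M :=
  exists (m n : nat) (f : {linear 'rV[R]_m -> 'rV[R]_n})
         (g : {linear 'rV[R]_n -> M}),
    (forall x, exists v, g v = x) /\
    (forall v, g v = 0 <-> exists u, f u = v).

Definition Add_class A X :=
  exists (I : choiceType) (F : I -> lmodType R), (forall i, A (F i)) /\
    exists Y : lmodType R, lmod_iso (X * Y)%type (coprod F).

Definition add_class A X :=
  exists (I : finType) (F : I -> lmodType R), (forall i, A (F i)) /\
    exists Y : lmodType R, lmod_iso (X * Y)%type (coprod F).

Definition sub_class A S :=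
  finitely_presented S /\
  exists M, A M /\ exists i : {linear S -> M}, injective i.

(* Left ideals are, up to isomorphism, the modules embedding into R. *)
Definition left_coherent :=
  forall J : lmodType R, (exists i : {linear J -> R^o}, injective i) ->
    finitely_generated J -> finitely_presented J.

(* A complex stores the differential out of degree n+1 as [diff n], so that no
   transport along n + 1 - 1 = n is ever needed; as n ranges over all of int,
   so does n + 1. *)
Record complex := Complex {
  cobj :> int -> lmodType R;
  diff : forall n : int, {linear cobj (n + 1) -> cobj n};
  diffK : forall n x, diff n (diff (n + 1) x) = 0 }.

Definition hom_exact P (Y : complex) :=
  forall (n : int) (h : {linear P -> Y (n + 1)}),
    (forall x, diff Y n (h x) = 0) <->
    (exists k : {linear P -> Y (n + 1 + 1)},
       forall x, h x = diff Y (n + 1) (k x)).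

Definition pure_exact (Y : complex) :=
  forall N, finitely_presented N -> hom_exact N Y.

Definition pure_projective P := forall Y, pure_exact Y -> hom_exact P Y.

(* The sequence 0 -> P_d -> ... -> P_0 -> N -> 0 is the complex Y with
   P_i = Y_i, N in degree -1, and zero elsewhere. *)
Definition pure_resolution (d : nat) N (Y : complex) :=
  [/\ pure_exact Y,
      lmod_iso (Y (-1)) N,
      forall i : nat, (i <= d)%N -> pure_projective (Y i%:Z) &
      forall n : int, n < -1 \/ d%:Z < n -> forall x : Y n, x = 0].

Definition left_pure_gldim_le (d : nat) :=
  forall N, exists Y, pure_resolution d N Y.

Definition finite_left_pure_gldim := exists d, left_pure_gldim_le d.

End Modules.

Definition right_coherent (R : pzRingType) := left_coherent R^c.

Record bimodule (R : pzRingType) := Bimodule {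
  left_module :> lmodType R;
  ract : left_module -> R -> left_module;
  ractA : forall x a b, ract (ract x a) b = ract x (a * b);
  ract1 : forall x, ract x 1 = x;
  ractDl : forall x y a, ract (x + y) a = ract x a + ract y a;
  ractDr : forall x a b, ract x (a + b) = ract x a + ract x b;
  ractZ : forall a x b, ract (a *: x) b = a *: ract x b }.

(* A right R-module is a left module over the converse ring R^c. *)
Section RightModule.
Variables (R : pzRingType) (M : bimodule R).

Definition right_carrier : Type := M.
HB.instance Definition _ := GRing.Zmodule.on right_carrier.

Let rscale (a : R^c) (x : right_carrier) : right_carrier := @ract R M x a.
Fact rscaleA a b x : rscale a (rscale b x) = rscale (a * b) x.
Proof. exact: ractA. Qed.
Fact rscale1 : left_id 1 rscale.
Proof. exact: ract1. Qed.
Fact rscaleDr : right_distributive rscale +%R.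
Proof. by move=> a x y; exact: ractDl. Qed.
Fact rscaleDl x : {morph rscale^~ x : a b / a + b}.
Proof. by move=> a b; exact: ractDr. Qed.
HB.instance Definition _ := GRing.Zmodule_isLmodule.Build R^c right_carrier
  rscaleA rscale1 rscaleDr rscaleDl.

Definition right_module : lmodType R^c := right_carrier.
End RightModule.

Record preadditive := Preadditive {
  obj :> Type;
  hom : obj -> obj -> zmodType;
  idm : forall X, hom X X;
  comp : forall X Y Z, hom Y Z -> hom X Y -> hom X Z;
  compA : forall W X Y Z (h : hom Y Z) (g : hom X Y) (f : hom W X),
    comp h (comp g f) = comp (comp h g) f;
  comp1m : forall X Y (f : hom X Y), comp (idm Y) f = f;
  compm1 : forall X Y (f : hom X Y), comp f (idm X) = f;
  compDl : forall X Y Z (g h : hom Y Z) (f : hom X Y),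
    comp (g + h) f = comp g f + comp h f;
  compDr : forall X Y Z (h : hom Y Z) (f g : hom X Y),
    comp h (f + g) = comp h f + comp h g }.

Arguments hom {p} X Y.
Arguments idm {p} X.
Arguments comp {p X Y Z} g f.

Section CompactlyGenerated.
Variable C : preadditive.

Definition isomorphic (X Y : C) :=
  exists (f : hom X Y) (g : hom Y X), comp g f = idm X /\ comp f g = idm Y.

Definition zero_object (Z : C) :=
  forall X : C, (forall f : hom Z X, f = 0) /\ (forall f : hom X Z, f = 0).

Definition is_coproduct (I : choiceType) (X : I -> C) (S : C)
    (inj : forall i, hom (X i) S) :=
  forall (Y : C) (f : forall i, hom (X i) Y),
    exists! g : hom S Y, forall i, comp g (inj i) = f i.

Definition has_coproducts :=
  forall (I : choiceType) (X : I -> C),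
    exists (S : C) (inj : forall i, hom (X i) S), is_coproduct inj.

Definition compact (K : C) :=
  forall (I : choiceType) (X : I -> C) (S : C) (inj : forall i, hom (X i) S),
    is_coproduct inj ->
    bijective (fun f : dsum (fun i => hom K (X i)) =>
                 (\sum_(i \in [set: I]) comp (inj i) (f i) : hom K S)).

(* The condition involves only the underlying additive category, not the
   shift or the triangles. *)
Definition compactly_generated :=
  has_coproducts /\
  exists (J : choiceType) (G : J -> C),
    (forall j, compact (G j)) /\
    (forall X : C, (forall j (f : hom (G j) X), f = 0) ->
       exists Z : C, zero_object Z /\ isomorphic X Z).

End CompactlyGenerated.

Lemma linear_ext (R : pzRingType) (U V : lmodType R) (f g : {linear U -> V}) :
  f =1 g -> f = g.
Proof.
move=> /funext; case: f g => [f cf] [g cg] /= fg.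
case: _ / fg cg => cg; congr GRing.Linear.Pack.
case: cf cg => [[a] [b]] [[a'] [b']].
by rewrite (Prop_irrelevance a a') (Prop_irrelevance b b').
Qed.

Section ChainMaps.
Variable R : pzRingType.

Section Hom.
Variables Y Z : complex R.

Record chain_map := ChainMap {
  cmap :> forall n, {linear Y n -> Z n};
  cmap_diff : forall n x, cmap n (diff Y n x) = diff Z n (cmap (n + 1) x) }.

HB.instance Definition _ := gen_eqMixin chain_map.
HB.instance Definition _ := gen_choiceMixin chain_map.

Lemma chain_mapP (f g : chain_map) : (forall n, f n =1 g n) -> f = g.
Proof.
case: f g => [f hf] [g hg] /= fg.
have {}fg : f = g := functional_extensionality_dep (fun n => linear_ext (fg n)).
by rewrite -fg in hg *; rewrite (Prop_irrelevance hf hg).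
Qed.

Fact cm0_diff n x : (\0 : {linear Y n -> Z n}) (diff Y n x) =
  diff Z n ((\0 : {linear Y (n + 1) -> Z (n + 1)}) x).
Proof. by rewrite /= linear0. Qed.
Definition cm0 := ChainMap cm0_diff.

Fact cmN_diff (f : chain_map) n x :
  (\- f n : {linear Y n -> Z n}) (diff Y n x) =
  diff Z n ((\- f (n + 1) : {linear Y (n + 1) -> Z (n + 1)}) x).
Proof. by rewrite /= linearN cmap_diff. Qed.
Definition cmN f := ChainMap (cmN_diff f).

Fact cmD_diff (f g : chain_map) n x :
  (f n \+ g n : {linear Y n -> Z n}) (diff Y n x) =
  diff Z n ((f (n + 1) \+ g (n + 1) : {linear Y (n + 1) -> Z (n + 1)}) x).
Proof. by rewrite /= linearD !cmap_diff. Qed.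
Definition cmD f g := ChainMap (cmD_diff f g).

Fact cmDA : associative cmD.
Proof. by move=> f g h; apply: chain_mapP => n x; exact: addrA. Qed.
Fact cmDC : commutative cmD.
Proof. by move=> f g; apply: chain_mapP => n x; exact: addrC. Qed.
Fact cm0D : left_id cm0 cmD.
Proof. by move=> f; apply: chain_mapP => n x; exact: add0r. Qed.
Fact cmND : left_inverse cm0 cmN cmD.
Proof. by move=> f; apply: chain_mapP => n x; exact: addNr. Qed.
HB.instance Definition _ :=
  GRing.isZmodule.Build chain_map cmDA cmDC cm0D cmND.

(* f_{n+1} = d_{n+2} s_{n+1} + s_n d_{n+1}, for all n. *)
Definition null_homotopic (f : chain_map) :=
  exists s : forall n, {linear Y n -> Z (n + 1)},
    forall n x, f (n + 1) x = diff Z (n + 1) (s (n + 1) x) + s n (diff Y n x).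

Definition null_homotopicb : {pred chain_map} :=
  fun f => `[< null_homotopic f >].

Fact null_homotopic_closed : zmod_closed null_homotopicb.
Proof.
split=> [|f g /asboolP[s fs] /asboolP[t gt]]; apply/asboolP.
  exists (fun n => \0 : {linear Y n -> Z (n + 1)}) => n x.
  by rewrite /= linear0 addr0.
exists (fun n => s n \- t n : {linear Y n -> Z (n + 1)}) => n x.
rewrite /= linearB addrACA -opprD -fs -gt; reflexivity.
Qed.
HB.instance Definition _ :=
  GRing.isZmodClosed.Build chain_map null_homotopicb null_homotopic_closed.

(* Chain maps modulo homotopy. *)
Definition khom : zmodType := Quotient.quot null_homotopicb.

Lemma khomP (f g : chain_map) :
  \pi_khom f = \pi_khom g <-> null_homotopic (f - g).
Proof.
rewrite (rwP eqP) -Quotient.idealrBE; split; first by move/asboolP.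
by move=> h; apply/asboolP.
Qed.

End Hom.

Fact cm1_diff (Y : complex R) n x :
  (idfun : {linear Y n -> Y n}) (diff Y n x) =
  diff Y n ((idfun : {linear Y (n + 1) -> Y (n + 1)}) x).
Proof. by []. Qed.
Definition cm1 Y := ChainMap (@cm1_diff Y).

Fact cmM_diff (X Y Z : complex R) (g : chain_map Y Z) (f : chain_map X Y) n x :
  (g n \o f n : {linear X n -> Z n}) (diff X n x) =
  diff Z n ((g (n + 1) \o f (n + 1) : {linear X (n + 1) -> Z (n + 1)}) x).
Proof. by rewrite /= !cmap_diff. Qed.
Definition cmM X Y Z g f := ChainMap (@cmM_diff X Y Z g f).

Lemma null_homotopicMl X Y Z (g : chain_map Y Z) (f : chain_map X Y) :
  null_homotopic f -> null_homotopic (cmM g f).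
Proof.
case=> s fs; exists (fun n => g (n + 1) \o s n : {linear X n -> Z (n + 1)}).
by move=> n x; rewrite /= fs linearD cmap_diff.
Qed.

Lemma null_homotopicMr X Y Z (g : chain_map Y Z) (f : chain_map X Y) :
  null_homotopic g -> null_homotopic (cmM g f).
Proof.
case=> s gs; exists (fun n => s n \o f n : {linear X n -> Z (n + 1)}).
by move=> n x; rewrite /= gs cmap_diff.
Qed.

Lemma null_homotopicD X Y (f g : chain_map X Y) :
  null_homotopic f -> null_homotopic g -> null_homotopic (f + g).
Proof.
move=> [s fs] [t gt]; exists (fun n => s n \+ t n : {linear X n -> Y (n + 1)}).
move=> n x; rewrite /= linearD addrACA -fs -gt; reflexivity.
Qed.

Definition kcomp X Y Z (g : khom Y Z) (f : khom X Y) : khom X Z :=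
  \pi_(khom X Z) (cmM (repr g) (repr f)).

Lemma kcompE X Y Z (g : chain_map Y Z) (f : chain_map X Y) :
  kcomp (\pi_(khom Y Z) g) (\pi_(khom X Y) f) = \pi_(khom X Z) (cmM g f).
Proof.
rewrite /kcomp; set g' := repr _; set f' := repr _.
have hg : null_homotopic (g' - g) by apply/khomP; rewrite reprK.
have hf : null_homotopic (f' - f) by apply/khomP; rewrite reprK.
apply/khomP.
have -> : cmM g' f' - cmM g f = cmM (g' - g) f' + cmM g (f' - f).
  apply: chain_mapP => n x.
  change (g' n (f' n x) - g n (f n x) =
    g' n (f' n x) - g n (f' n x) + g n (f' n x - f n x)).
  by rewrite linearB addrA subrK.
by apply: null_homotopicD; [exact: null_homotopicMr|exact: null_homotopicMl].
Qed.

Lemma khom_ind X Y (P : khom X Y -> Prop) :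
  (forall f : chain_map X Y, P (\pi_(khom X Y) f)) -> forall f, P f.
Proof. by move=> Pf f; rewrite -[f]reprK. Qed.

Lemma khomD X Y (f g : chain_map X Y) :
  \pi_(khom X Y) f + \pi_(khom X Y) g = \pi_(khom X Y) (f + g).
Proof. by rewrite !piE. Qed.

Fact kcompA W X Y Z (h : khom Y Z) (g : khom X Y) (f : khom W X) :
  kcomp h (kcomp g f) = kcomp (kcomp h g) f.
Proof.
elim/khom_ind: h => h; elim/khom_ind: g => g; elim/khom_ind: f => f.
by rewrite !kcompE; congr (\pi_(khom _ _)); exact: chain_mapP.
Qed.
Fact kcomp1m X Y (f : khom X Y) : kcomp (\pi_(khom Y Y) (cm1 Y)) f = f.
Proof.
elim/khom_ind: f => f.
by rewrite kcompE; congr (\pi_(khom _ _)); exact: chain_mapP.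
Qed.
Fact kcompm1 X Y (f : khom X Y) : kcomp f (\pi_(khom X X) (cm1 X)) = f.
Proof.
elim/khom_ind: f => f.
by rewrite kcompE; congr (\pi_(khom _ _)); exact: chain_mapP.
Qed.
Fact kcompDl X Y Z (g h : khom Y Z) (f : khom X Y) :
  kcomp (g + h) f = kcomp g f + kcomp h f.
Proof.
elim/khom_ind: g => g; elim/khom_ind: h => h; elim/khom_ind: f => f.
by rewrite khomD !kcompE khomD; congr (\pi_(khom _ _)); exact: chain_mapP.
Qed.
Fact kcompDr X Y Z (h : khom Y Z) (f g : khom X Y) :
  kcomp h (f + g) = kcomp h f + kcomp h g.
Proof.
elim/khom_ind: g => g; elim/khom_ind: h => h; elim/khom_ind: f => f.
rewrite khomD !kcompE khomD; congr (\pi_(khom _ _)).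
by apply: chain_mapP => n x; exact: linearD.
Qed.

End ChainMaps.

Record complex_in (R : pzRingType) (A : lmodType R -> Prop) := ComplexIn {
  complex_of :> complex R;
  complex_inP : forall n, A (complex_of n) }.

Definition K (R : pzRingType) (A : lmodType R -> Prop) : preadditive :=
  @Preadditive (complex_in A) (fun X Y => khom X Y)
    (fun X => \pi_(khom X X) (cm1 X)) (fun X Y Z => @kcomp R X Y Z)
    (fun W X Y Z => @kcompA R W X Y Z) (fun X Y => @kcomp1m R X Y)
    (fun X Y => @kcompm1 R X Y) (fun X Y Z => @kcompDl R X Y Z)
    (fun X Y Z => @kcompDr R X Y Z).

(* Main.v *)
From HB Require Import structures.
From mathcomp Require Import all_boot all_algebra.
From mathcomp Require Import boolp classical_sets cardinality fsbigop.
Require Import Defs.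

Set Implicit Arguments.
Unset Strict Implicit.
Unset Printing Implicit Defensive.

(** Write B for the class sub(add M). The reason for the theorem is that stalk
    complexes on modules of B already detect pure exactness among complexes
    over Add B.

    Let N be finitely presented. Since R is right coherent and M is finitely
    presented on the right, the right module Hom(N, M), the kernel of a map
    between finite powers of M, is generated by finitely many f_1, ..., f_l
    ([right_fg_hom]). The image S of (f_1, ..., f_l) : N -> M^l is finitely
    presented by left coherence, hence lies in B, and every map N -> M vanishes
    on the kernel of the surjection N -> S because it is a combination of the
    f_t with right coefficients ([universal_quotient]). Modules of Add B are
    cogenerated by M ([Add_sub_cogenerated]), so every map from N to such a
    module factors through S.

    The compact generators are the stalk complexes S[k] with S in B, one S for
    each finite presentation. They are compact because a map from a finitely
    generated module into a direct sum meets finitely many summands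
    ([stalk_small], [small_compact]). If all maps S[k] -> X are null-homotopic,
    then Hom(S, X) is exact for all S in B ([stalk_hom_exact]), hence Hom(N, X)
    is exact for all finitely presented N ([universal_quotient_hom_exact]): X
    is pure exact. Its terms are pure projective, and over a ring of finite
    left pure global dimension such a complex is contractible
    ([pure_exact_contractible]), because comparing it with a finite pure
    resolution of its cycles makes the identity null-homotopic beyond the
    length of the resolution. *)

Import GRing.Theory.
Local Open Scope ring_scope.
Local Open Scope quotient_scope.

(** * Submodules and linear maps *)

Definition lin (R : pzRingType) (U V : lmodType R) (f : U -> V)
    (lf : linear f) : {linear U -> V} :=
  HB.pack f (GRing.isLinear.Build R U V *:%R f lf).

Section Submodules.
Variables (R : pzRingType) (V : lmodType R).

(** Membership and its closure proof are bundled so that the module structure of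
    [submod s] can be inferred from [s] alone. *)
Record submodule := Submodule {
  submodule_mem : {pred V};
  submodule_closed : submod_closed submodule_mem }.

HB.instance Definition _ (s : submodule) :=
  GRing.isSubmodClosed.Build R V (submodule_mem s) (submodule_closed s).

Definition submod (s : submodule) := {x : V | x \in submodule_mem s}.

HB.instance Definition _ (s : submodule) := SubType.on (submod s).
HB.instance Definition _ (s : submodule) := Choice.on (submod s).
HB.instance Definition _ (s : submodule) :=
  [SubChoice_isSubLmodule of submod s by <:].

Definition sub_incl (s : submodule) : {linear submod s -> V} := val.

Lemma sub_incl_inj s : injective (sub_incl s).
Proof. exact: val_inj. Qed.

Lemma sub_incl_mem s x : sub_incl s x \in submodule_mem s.
Proof. exact: valP. Qed.

Lemma corestrict (U : lmodType R) (f : {linear U -> V}) (s : submodule) :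
  (forall x, f x \in submodule_mem s) ->
  exists g : {linear U -> submod s}, forall x, sub_incl s (g x) = f x.
Proof.
move=> fs; pose g x : submod s := exist _ (f x) (fs x).
have lg : linear g.
  by move=> a x y; apply: val_inj; rewrite linearP /= linearP.
by exists (lin lg).
Qed.

End Submodules.

Section LinearMaps.
Variable R : pzRingType.
Implicit Types U V W : lmodType R.

Fact image_closed U V (f : {linear U -> V}) :
  submod_closed (fun y => `[< exists x, f x = y >] : bool).
Proof.
split=> [|a x y /asboolP[u <-] /asboolP[v <-]]; apply/asboolP.
  by exists 0; rewrite linear0.
by exists (a *: u + v); rewrite linearP.
Qed.
Definition image U V (f : {linear U -> V}) := Submodule (image_closed f).

Lemma image_corestrict U V (f : {linear U -> V}) :
  exists2 q : {linear U -> submod (image f)},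
    forall x, sub_incl _ (q x) = f x & forall y, exists x, q x = y.
Proof.
have imf x : f x \in submodule_mem (image f) by apply/asboolP; exists x.
have [q qE] := corestrict imf; exists q => // y.
have /asboolP[x xy] := sub_incl_mem y.
by exists x; apply: sub_incl_inj; rewrite qE.
Qed.

Fact kernel_closed U V (f : {linear U -> V}) :
  submod_closed (fun x => f x == 0).
Proof.
split=> [|a x y /eqP fx /eqP fy]; rewrite unfold_in ?linear0 ?linearP //=.
by rewrite fx fy scaler0 addr0.
Qed.
Definition kernel U V (f : {linear U -> V}) := Submodule (kernel_closed f).

Lemma kernel_incl U V (f : {linear U -> V}) x :
  f (sub_incl (kernel f) x) = 0.
Proof. by apply/eqP; have := sub_incl_mem x; rewrite unfold_in. Qed.

Lemma factor_surj U V W (p : {linear U -> V}) (f : {linear U -> W}) :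
  (forall y, exists x, p x = y) -> (forall x, p x = 0 -> f x = 0) ->
  exists g : {linear V -> W}, forall x, g (p x) = f x.
Proof.
move=> surj kpf; have [s ps] := choice surj.
have fs x : f (s (p x)) = f x.
  by apply/eqP; rewrite -subr_eq0 -linearB kpf // linearB ps subrr.
have lg : linear (f \o s).
  move=> a x y /=; rewrite -{1}(ps x) -{1}(ps y) -linearP fs.
  by rewrite linearP.
by exists (lin lg).
Qed.

End LinearMaps.

(** * Coproducts of modules *)

Lemma dsum_support (I : choiceType) (A : I -> zmodType) (f : dsum A) :
  exists2 s : seq I, uniq s & forall i, i \notin s -> f i = 0.
Proof.
have /finite_seqP[s sE] := dsum_fin f.
exists (undup s) => [|i]; first exact: undup_uniq.
rewrite mem_undup => /negP is_; apply/eqP/negPn/negP => fi0; apply: is_.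
have : [set i | f i != 0]%classic i by [].
by rewrite sE.
Qed.

Section Coproducts.
Variables (R : pzRingType) (I : choiceType) (A : I -> lmodType R).
Local Notation D := (coprod A).

Lemma coprodP (f g : D) : (forall i, f i = g i) -> f = g.
Proof. exact: dsumP. Qed.

Fact coprod_proj_linear i : linear (fun f : D => f i).
Proof. by []. Qed.
Definition coprod_proj i : {linear D -> A i} := lin (@coprod_proj_linear i).

Definition single i (x : A i) : forall j, A j :=
  @dfwith I A (fun j => 0) i x.

Lemma single_eq i (x : A i) : single x i = x.
Proof. exact: dfwith_in. Qed.

Lemma single_neq i (x : A i) j : i != j -> single x j = 0.
Proof. exact: dfwith_out. Qed.

Fact single_fin i (x : A i) : finite_set [set j | single x j != 0].
Proof.
apply: (sub_finite_set _ (finite_set1 i)) => j /=.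
by have [<-//|/single_neq->] := eqVneq i j; rewrite eqxx.
Qed.

Fact coprod_in_linear i : linear (fun x : A i => DSum (single_fin x) : D).
Proof.
move=> a x y; apply: coprodP => j.
change (single (a *: x + y) j = a *: single x j + single y j).
have [<-|ij] := eqVneq i j; first by rewrite !single_eq.
by rewrite !single_neq // scaler0 addr0.
Qed.
Definition coprod_in i : {linear A i -> D} := lin (@coprod_in_linear i).

Lemma coprod_in_eq i (x : A i) : coprod_in i x i = x.
Proof. exact: single_eq. Qed.

Lemma coprod_in_neq i j (x : A i) : i != j -> coprod_in i x j = 0.
Proof. exact: single_neq. Qed.

Section Elim.
Variables (W : lmodType R) (k : forall i, {linear A i -> W}).

Definition coprod_elim_fun (f : D) : W :=
  \sum_(i \in [set: I]) k i (f i).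

Lemma coprod_elim_funE (f : D) (s : seq I) :
  uniq s -> (forall i, i \notin s -> f i = 0) ->
  coprod_elim_fun f = \sum_(i <- s) k i (f i).
Proof.
move=> us fs; rewrite /coprod_elim_fun (fsbigE s) //.
  by apply: eq_bigl => i; rewrite in_setT.
by move=> i _ /fs->; rewrite linear0.
Qed.

Fact coprod_elim_linear : linear coprod_elim_fun.
Proof.
move=> a f g; have [s us fs] := dsum_support f.
have [t ut gt] := dsum_support g.
have fgs i : i \notin undup (s ++ t) -> f i = 0 /\ g i = 0.
  by rewrite mem_undup mem_cat negb_or => /andP[/fs-> /gt->].
have ust := undup_uniq (s ++ t).
have hf i : i \notin undup (s ++ t) -> f i = 0 by move=> /fgs[].
have hg i : i \notin undup (s ++ t) -> g i = 0 by move=> /fgs[].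
rewrite (coprod_elim_funE ust hf) (coprod_elim_funE ust hg).
rewrite (@coprod_elim_funE (a *: f + g) _ ust).
  rewrite scaler_sumr -big_split; apply: eq_bigr => i _ /=.
  by rewrite -linearP.
move=> i /fgs[fi gi]; change (a *: f i + g i = 0).
by rewrite fi gi scaler0 addr0.
Qed.
Definition coprod_elim : {linear D -> W} := lin coprod_elim_linear.

Lemma coprod_elim_in i (x : A i) : coprod_elim (coprod_in i x) = k i x.
Proof.
change (coprod_elim_fun (coprod_in i x) = k i x).
rewrite (@coprod_elim_funE _ [:: i]) ?big_seq1 ?coprod_in_eq //.
by move=> j; rewrite inE eq_sym => /coprod_in_neq->.
Qed.

End Elim.

Lemma coprod_sum_in (f : D) (s : seq I) :
  uniq s -> (forall i, i \notin s -> f i = 0) ->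
  f = \sum_(i <- s) coprod_in i (f i).
Proof.
move=> us fs; apply: coprodP => j.
have -> : (\sum_(i <- s) coprod_in i (f i)) j =
    \sum_(i <- s) coprod_in i (f i) j :> A j.
  exact: (linear_sum (coprod_proj j)).
have [js|js] := boolP (j \in s); last first.
  rewrite fs // big_seq big1 // => i is_.
  by rewrite coprod_in_neq //; apply: contraNneq js => <-.
rewrite (bigD1_seq j js us) coprod_in_eq big1 => [|i ij].
  by rewrite /= addr0.
exact: coprod_in_neq.
Qed.

Lemma coprod_ext (W : lmodType R) (g h : {linear D -> W}) :
  (forall i (x : A i), g (coprod_in i x) = h (coprod_in i x)) -> g =1 h.
Proof.
move=> gh f; have [s us fs] := dsum_support f.
rewrite (coprod_sum_in us fs) !linear_sum.
by apply: eq_bigr => i _; exact: gh.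
Qed.

End Coproducts.

(** * Kernels over coherent rings *)

Section Coherence.
Variable T : pzRingType.
Implicit Types V W : lmodType T.

Lemma lift_matrix V a b (q : {linear 'rV[T]_a -> V}) (g : {linear 'rV[T]_b -> V}) :
  (forall v, exists u, q u = g v) ->
  exists P : 'M[T]_(b, a), forall v, q (v *m P) = g v.
Proof.
move=> gq; have [p pg] := choice (fun i => gq (delta_mx 0 i)).
exists (\matrix_i p i) => v.
rewrite mulmx_sum_row {2}(row_sum_delta v) !linear_sum.
by apply: eq_bigr => i _; rewrite !linearZ rowK pg.
Qed.

(** The rows of [B] generate the syzygies of the rows of [A]; required of all [A],
    this is coherence in matrix form. *)
Definition fg_left_kernel k n (A : 'M[T]_(k, n)) :=
  exists l (B : 'M[T]_(l, k)), forall c : 'rV_k,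
    c *m A = 0 <-> exists e, c = e *m B.

(** The rows of a single column generate a left ideal, finitely presented by
    coherence. Writing its two generating families in terms of each other by
    matrices [P] and [Q], the relations between the rows of [A] are generated
    by those of the given presentation, carried over by [P], and by the rows of
    1 - Q P, which measure how the round trip differs from the identity. *)
Lemma fg_left_kernel_col k (A : 'M[T]_(k, 1)) :
  left_coherent T -> fg_left_kernel A.
Proof.
move=> coh; have lf : linear (fun c : 'rV[T]_k => (c *m A) 0 0 : T^o).
  by move=> a x y; rewrite mulmxDl -scalemxAl !mxE.
have [q qE qsurj] := image_corestrict (lin lf).
have q0 c : q c = 0 <-> c *m A = 0.
  transitivity ((c *m A) 0 0 = 0).
    rewrite -[(c *m A) 0 0]qE; split=> [->|qc0]; first exact: linear0.
    by apply: sub_incl_inj; rewrite linear0.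
  by split=> [cA|->]; [apply/rowP => i; rewrite ord1 cA mxE|rewrite mxE].
have Jfg : finitely_generated (submod (image (lin lf))) by exists k, q.
have Jsub : exists i : {linear submod (image (lin lf)) -> T^o}, injective i.
  by exists (@sub_incl _ _ _); exact: sub_incl_inj.
have [m [n [phi [g [gsurj kerg]]]]] := coh _ Jsub Jfg.
have [P gP] := lift_matrix (fun v => qsurj (g v)).
have [Q qQ] := lift_matrix (fun v => gsurj (q v)).
exists (k + m)%N, (col_mx (1%:M - Q *m P) (lin1_mx phi *m P)) => c.
split=> [/q0 qc|[e ->]].
  have /kerg[u uE] : g (c *m Q) = 0 by rewrite qQ.
  exists (row_mx c u); rewrite mul_row_col mulmxBr mulmx1 !mulmxA.
  by rewrite mul_rV_lin1 uE subrK.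
apply/q0; rewrite -[e]hsubmxK mul_row_col mulmxBr mulmx1 !mulmxA.
rewrite mul_rV_lin1 linearD linearB !gP qQ subrr add0r.
by apply/kerg; exists (rsubmx e).
Qed.

(** Induction on the number of columns: the relations for all but one column are
    the combinations of finitely many, and among those combinations the
    relations for the remaining column are again finitely generated. *)
Lemma coherent_fg_left_kernel k n (A : 'M[T]_(k, n)) :
  left_coherent T -> fg_left_kernel A.
Proof.
move=> coh; elim: n => [|n IHn] in A *.
  exists k, 1%:M => c; split=> _; last by apply/rowP => -[].
  by exists c; rewrite mulmx1.
move: A; rewrite -[n.+1]/(1 + n)%N => A.
have [l [B kB]] := IHn (rsubmx A).
have [l' [B' kB']] := fg_left_kernel_col (B *m lsubmx A) coh.
exists l', (B' *m B) => c; rewrite -[A]hsubmxK mul_mx_row.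
split=> [cA|[e ->]].
  have [/= cl cr] : c *m lsubmx A = 0 /\ c *m rsubmx A = 0.
    by apply: eq_row_mx; rewrite row_mx0.
  have [e ce] := (kB c).1 cr.
  have /kB'[e' ee'] : e *m (B *m lsubmx A) = 0 by rewrite mulmxA -ce.
  by exists e'; rewrite mulmxA -ee'.
rewrite mulmxA -!mulmxA.
have -> : e *m (B' *m (B *m lsubmx A)) = 0.
  by rewrite mulmxA; apply/kB'; exists e.
have -> : e *m (B' *m (B *m rsubmx A)) = 0.
  by rewrite 2!mulmxA; apply/kB; exists (e *m B').
by rewrite row_mx0.
Qed.

(** If V has generators g and relations phi, a vector is killed by psi exactly
    when its lift along g is a combination of relations, so the kernel is a
    projection of the left kernel of a block matrix. *)
Lemma coherent_fg_kernel V a (psi : {linear 'rV[T]_a -> V}) :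
  left_coherent T -> finitely_presented V ->
  exists l (B : 'M[T]_(l, a)), forall v, psi v = 0 <-> exists e, v = e *m B.
Proof.
move=> coh [m [n [phi [g [gsurj kerg]]]]].
have [C gC] := lift_matrix (fun v => gsurj (psi v)).
have [l [B kB]] := coherent_fg_left_kernel (col_mx C (lin1_mx phi)) coh.
exists l, (lsubmx B) => v; rewrite -gC kerg; split=> [[u uE]|[e ->]].
  have /kB[e eE] : row_mx v (- u) *m col_mx C (lin1_mx phi) = 0.
    by rewrite mul_row_col mulNmx mul_rV_lin1 uE subrr.
  by exists e; rewrite mulmx_lsub -eE row_mxKl.
exists (- (e *m rsubmx B)); rewrite linearN -(mul_rV_lin1 phi).
apply/esym/eqP; rewrite -addr_eq0 mulmx_lsub mulmx_rsub -mul_row_col hsubmxK.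
by apply/eqP/kB; exists e.
Qed.

Lemma coherent_fg_kernels (I : eqType) (s : seq I) V a
    (psi : I -> {linear 'rV[T]_a -> V}) :
  left_coherent T -> finitely_presented V ->
  exists l (B : 'M[T]_(l, a)), forall v,
    (forall i, i \in s -> psi i v = 0) <-> exists e, v = e *m B.
Proof.
move=> coh fpV; elim: s => [|i s [l [B kB]]].
  by exists a, 1%:M => v; split=> [_|_ i //]; exists v; rewrite mulmx1.
have [l' [B' kB']] := coherent_fg_kernel
  (psi i \o mulmxr B : {linear 'rV_l -> V}) coh fpV.
exists l', (B' *m B) => v; split=> [psi0|[e ->] j].
  have [|e ve] := (kB v).1.
    by move=> j js; rewrite psi0 // inE js orbT.
  have [|e' ee'] := (kB' e).1; first by rewrite /= -ve psi0 // mem_head.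
  by exists e'; rewrite mulmxA -ee'.
rewrite inE mulmxA => /predU1P[->|js].
  by apply: (kB' _).2; exists e.
by apply: (kB _).2 js; exists (e *m B').
Qed.

End Coherence.

(** * The universal quotient of a finitely presented module *)

Section UniversalQuotient.
Variables (R : pzRingType) (M : bimodule R).

(** Right multiplication by a scalar is left linear: this is where M being a
    bimodule enters. *)
Fact ract_linear a : linear (fun x : left_module M => ract x a).
Proof. by move=> b x y; rewrite ractDl ractZ. Qed.
Definition rmul a : {linear left_module M -> left_module M} :=
  lin (ract_linear a).

Lemma right_moduleZ (a : R) (x : M) :
  (a : R^c) *: (x : right_module M) = rmul a x.
Proof. by []. Qed.

Fact lincomb_linear n (y : 'I_n -> M) :
  linear (fun v : 'rV[R]_n => \sum_j v 0 j *: y j).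
Proof.
move=> a u v; rewrite scaler_sumr -big_split; apply: eq_bigr => j _ /=.
by rewrite !mxE scalerDl scalerA.
Qed.
Definition lincomb n y := lin (@lincomb_linear n y).

Lemma lincomb_delta n (f : {linear 'rV[R]_n -> M}) v :
  f v = lincomb (fun j => f (delta_mx 0 j)) v.
Proof.
rewrite {1}(row_sum_delta v) linear_sum.
by apply: eq_bigr => j _; rewrite linearZ.
Qed.

(** For N with q generators and p relations, Hom(N, M) is the set of the q-tuples
    in M that satisfy the p relations. Parametrizing M^q by a free right module
    turns this into a finite intersection of kernels, finitely generated by
    right coherence. If every generator F_t of Hom(N, M) vanishes at x, so does
    every right combination of them. *)
Lemma right_fg_hom N : right_coherent R -> finitely_presented (right_module M) ->
  finitely_presented N ->
  exists l (F : 'I_l -> {linear N -> left_module M}),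
    forall (f : {linear N -> left_module M}) x,
      (forall t, F t x = 0) -> f x = 0.
Proof.
move=> coh fpM [p [q [phi [gN [gNsurj kergN]]]]].
have [_ [n [_ [g [gsurj _]]]]] := fpM; pose A := lin1_mx phi.
pose y (v : 'rV[R^c]_(q * n)) j : M := g (row j (vec_mx v)).
have lpsi i : linear (fun v => \sum_j A i j *: y v j : right_module M).
  move=> a u v; rewrite right_moduleZ linear_sum -big_split; apply: eq_bigr => j _.
  change (A i j *: y (a *: u + v) j = rmul a (A i j *: y u j) + A i j *: y v j).
  rewrite linearZ -scalerDr; congr (_ *: _); rewrite -right_moduleZ.
  by rewrite /y !linearP.
(* The i-th map is the i-th relation of N; it is right linear since left and
   right multiplications on M commute. *)
have [l [B kB]] := coherent_fg_kernels (enum 'I_p)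
  (fun i => lin (lpsi i)) coh fpM.
have relB t i : \sum_j A i j *: y (row t B) j = 0.
  by apply: ((kB (row t B)).2 _ i (mem_enum _ i)); exists 'e_t; exact: rowE.
have gen_ker t v : gN v = 0 -> lincomb (y (row t B)) v = 0.
  move=> /kergN[u <-]; rewrite -mul_rV_lin1 mulmx_sum_row linear_sum.
  rewrite big1 // => i _; rewrite linearZ_LR.
  have -> : lincomb (y (row t B)) (row i (lin1_mx phi)) = 0.
    by rewrite -[RHS](relB t i); apply: eq_bigr => j _; rewrite mxE.
  by rewrite scaler0.
have [F FE] := choice (fun t => factor_surj gNsurj (gen_ker t)).
exists l, F => f x; have [v <-] := gNsurj x => Fv.
have fgN u : f (gN u) = lincomb (fun j => f (gN (delta_mx 0 j))) u.
  exact: (lincomb_delta (f \o gN)).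
have [c cE] := choice (fun j => gsurj (f (gN (delta_mx 0 j)))).
pose w : 'rV[R^c]_(q * n) := mxvec (\matrix_j c j).
have yw j : y w j = f (gN (delta_mx 0 j)).
  by rewrite /y mxvecK rowK cE.
have [e we] : exists e, w = e *m B.
  apply/kB => i _; change (\sum_j A i j *: y w j = 0).
  have -> : \sum_j A i j *: y w j = f (gN (row i A)).
    by rewrite fgN; apply: eq_bigr => j _; rewrite yw [row i A _ _]mxE.
  suff -> : gN (row i A) = 0 by rewrite linear0.
  by apply/kergN; exists 'e_i; rewrite -mul_rV_lin1 -rowE.
rewrite fgN.
transitivity (\sum_t rmul (e 0 t) (lincomb (y (row t B)) v)).
  under eq_bigr => t _ do rewrite linear_sum.
  rewrite exchange_big; apply: eq_bigr => j _.
  under eq_bigr => t _ do rewrite linearZ_LR.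
  rewrite -scaler_sumr -yw; congr (_ *: _).
  by rewrite /y we mulmx_sum_row !linear_sum; apply: eq_bigr => t _; rewrite !linearZ.
by rewrite big1 // => t _; rewrite -FE Fv linear0.
Qed.

Lemma finite_power_add n :
  add_class (eq (left_module M)) (coprod (fun _ : 'I_n => left_module M)).
Proof.
exists 'I_n, (fun _ => left_module M); split=> //.
exists 'rV[R]_0, fst; exists (fun x => (x, 0)) => // -[x y] /=.
by congr (_, _); apply/rowP => -[].
Qed.

(** S is the image of N in M^l under a finite generating family of Hom(N, M). The
    last clause makes it universal: all maps from N to M, hence to any module
    cogenerated by M, factor through N -> S. *)
Lemma universal_quotient N : left_coherent R -> right_coherent R ->
  finitely_presented (left_module M) -> finitely_presented (right_module M) ->
  finitely_presented N ->
  exists2 S, sub_class (add_class (eq (left_module M))) S &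
    exists2 q : {linear N -> S}, (forall y, exists x, q x = y) &
      forall (f : {linear N -> left_module M}) x, q x = 0 -> f x = 0.
Proof.
move=> lcoh rcoh lfp rfp fpN; have [l [F genF]] := right_fg_hom rcoh rfp fpN.
have [_ [k [_ [gN [gNsurj _]]]]] := fpN.
pose Ml := coprod (fun _ : 'I_l => left_module M).
have lF : linear (fun x => \sum_t coprod_in _ t (F t x) : Ml).
  move=> a x y; rewrite scaler_sumr -big_split; apply: eq_bigr => t _.
  by rewrite !linearP.
have FE x t : lin lF x t = F t x.
  transitivity (\sum_i coprod_in (fun=> left_module M) i (F i x) t).
    exact: (linear_sum (coprod_proj (fun=> left_module M) t)).
  rewrite (bigD1 t isT) big1 => [|i it]; last exact: coprod_in_neq.
  by rewrite coprod_in_eq /= addr0.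
have [q qE qsurj] := image_corestrict (lin lF).
have q0 x : q x = 0 <-> forall t, F t x = 0.
  split=> [qx t|Fx]; first by rewrite -FE -qE qx linear0.
  by apply: sub_incl_inj; rewrite qE linear0; apply: coprodP => t; rewrite FE Fx.
exists (submod (image (lin lF))); last first.
  by exists q => // f x /q0; exact: genF.
split; last first.
  exists Ml; split; first exact: finite_power_add.
  by exists (@sub_incl _ _ _); exact: sub_incl_inj.
have [m [B kB]] := coherent_fg_kernels (enum 'I_l)
  (fun t => F t \o gN : {linear _ -> _}) lcoh lfp.
exists m, k, (mulmxr B), (q \o gN); split=> [y|v].
  by have [x <-] := qsurj y; have [v <-] := gNsurj x; exists v.
rewrite [X in X = 0]/(q (gN v)) q0; split=> [Fv|[e eB] t].
  have [|e ->] := (kB v).1; last by exists e.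
  by move=> t _; exact: Fv.
by apply: (kB v).2 (mem_enum _ t); exists e; rewrite -eB.
Qed.

End UniversalQuotient.

(** * The class Add *)

Fact inl_linear (R : pzRingType) (U V : lmodType R) :
  linear (fun x : U => (x, 0) : (U * V)%type).
Proof.
move=> a x y; change ((a *: x + y, 0) = (a *: x + y, a *: 0 + 0) :> U * V).
by rewrite scaler0 addr0.
Qed.
Definition inl_lin (R : pzRingType) (U V : lmodType R) := lin (@inl_linear R U V).

Section AddClosure.
Variables (R : pzRingType) (A : lmodType R -> Prop).
Implicit Types X Y : lmodType R.

Lemma lmod_iso_inverse X Y : lmod_iso X Y ->
  exists (f : {linear X -> Y}) (g : {linear Y -> X}), cancel f g /\ cancel g f.
Proof.
case=> f [g fK gK]; exists f.
have lg : linear g by exact: (can2_linear fK gK).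
by exists (lin lg).
Qed.

(** Retractions compose and pass to coproducts componentwise, whereas complements
    do so only up to isomorphisms that would have to be carried along. *)
Record add_data X := AddData {
  add_index : choiceType;
  add_family : add_index -> lmodType R;
  add_familyP : forall i, A (add_family i);
  add_in : {linear X -> coprod add_family};
  add_out : {linear coprod add_family -> X};
  add_inK : cancel add_in add_out }.

Lemma Add_class_data X : Add_class A X -> exists d : add_data X, True.
Proof.
case=> I [F [AF [Y /lmod_iso_inverse[f [g [fK gK]]]]]].
have l2 : linear (fun z => (g z).1).
  by move=> a x y; rewrite linearP.
have inK : cancel (f \o inl_lin X Y) (lin l2) by move=> x /=; rewrite fK.
by exists (AddData AF inK).
Qed.

Lemma data_Add_class X : add_data X -> Add_class A X.
Proof.
case=> I F AF i p ip; exists I, F; split=> //.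
exists (submod (kernel p)).
have lf : linear (fun z : X * submod (kernel p) => i z.1 + sub_incl (kernel p) z.2).
  move=> a [x y] [x' y'] /=.
  change (i (a *: x + x') + sub_incl (kernel p) (a *: y + y') =
          a *: (i x + sub_incl (kernel p) y) + (i x' + sub_incl (kernel p) y')).
  by rewrite !linearP scalerDr addrACA.
have pker z : (idfun \- (i \o p)) z \in submodule_mem (kernel p).
  by apply/eqP; rewrite /= linearB ip subrr.
have [c cE] := corestrict pker.
exists (lin lf), (fun z => (p z, c z)) => [[x y]|z]; last first.
  change (i (p z) + sub_incl (kernel p) (c z) = z).
  by rewrite cE /= addrC subrK.
have py : p (sub_incl (kernel p) y) = 0 by exact: kernel_incl.
have pz : p (i x + sub_incl (kernel p) y) = x by rewrite linearD ip py addr0.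
congr pair; first exact: pz.
apply: sub_incl_inj; rewrite cE.
change (i x + sub_incl (kernel p) y - i (p (i x + sub_incl (kernel p) y)) =
        sub_incl (kernel p) y).
by rewrite pz addrC addKr.
Qed.

Lemma Add_class_base X : A X -> Add_class A X.
Proof.
move=> AX; apply: data_Add_class.
apply: (@AddData _ unit (fun _ => X) (fun _ => AX)
  (coprod_in (fun _ => X) tt) (coprod_proj (fun _ => X) tt)) => x.
exact: (@coprod_in_eq _ _ (fun _ => X)).
Qed.

Lemma Add_class_retract X Y (i : {linear X -> Y}) (p : {linear Y -> X}) :
  cancel i p -> Add_class A Y -> Add_class A X.
Proof.
move=> ip /Add_class_data[[I F AF j q jq] _]; apply: data_Add_class.
apply: (@AddData _ I F AF (j \o i) (p \o q)) => x.
by rewrite /= jq ip.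
Qed.

Lemma Add_class_coprod (I : choiceType) (X : I -> lmodType R) :
  (forall i, Add_class A (X i)) -> Add_class A (coprod X).
Proof.
move=> AX; pose D i := projT1 (cid (Add_class_data (AX i))).
pose J := {i : I & add_index (D i)}.
pose F (k : J) := add_family (tagged k).
pose tg i (j : add_index (D i)) : J := Tagged (fun i => add_index (D i)) j.
pose e i : {linear coprod (@add_family _ (D i)) -> coprod F} :=
  coprod_elim (fun j => coprod_in F (tg i j)).
pose i_ : {linear coprod X -> coprod F} :=
  coprod_elim (fun i => e i \o add_in (D i)).
pose p : {linear coprod F -> coprod X} :=
  coprod_elim (fun k => coprod_in X (tag k) \o
    (add_out (D (tag k)) \o coprod_in (@add_family _ (D (tag k))) (tagged k))).
apply: data_Add_class; apply: (@AddData _ J F _ i_ p) => [k|].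
  exact: add_familyP.
have pe i : p \o e i =1 coprod_in X i \o add_out (D i).
  apply: coprod_ext => j x.
  have eE : e i (coprod_in _ j x) = coprod_in F (tg i j) x.
    exact: coprod_elim_in.
  apply: etrans (congr1 p eE) _; exact: coprod_elim_in.
apply: (@coprod_ext _ _ _ _ (p \o i_) idfun) => i x.
have iE : i_ (coprod_in X i x) = e i (add_in (D i) x).
  exact: coprod_elim_in.
apply: etrans (congr1 p iE) _; apply: etrans (pe i _) _.
by rewrite /= add_inK.
Qed.

End AddClosure.

(** A nonzero element of X has a nonzero component in some module of sub(add M),
    which embeds into a direct summand of a power of M. *)
Lemma Add_sub_cogenerated (R : pzRingType) (M X : lmodType R) (x : X) :
  Add_class (sub_class (add_class (eq M))) X ->
  (forall f : {linear X -> M}, f x = 0) -> x = 0.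
Proof.
case/Add_class_data=> -[I F AF i p ip] _ x0; rewrite -[x]ip.
suff -> : i x = 0 by rewrite linear0.
apply: coprodP => j; have [_ [B [[K [G [GM [Y]]]]]]] := AF j.
case/lmod_iso_inverse=> f [g [fK _]] [u u_inj].
apply: u_inj; rewrite linear0.
have -> : u (i x j) = (g (f (u (i x j), 0))).1 by rewrite fK.
suff -> : f (u (i x j), 0) = 0 by rewrite linear0.
apply: coprodP => k; move: (x0); rewrite (GM k) => {}x0.
exact: (x0 (coprod_proj G k \o (f \o (inl_lin B Y \o
  (u \o (coprod_proj F j \o i)))))).
Qed.

(** * Exactness of Hom into a complex *)

Section HomExact.
Variable R : pzRingType.
Implicit Types (P N X : lmodType R) (Y : complex R).

Lemma hom_exactI P Y :
  (forall n (h : {linear P -> Y (n + 1)}), (forall x, diff Y n (h x) = 0) ->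
    exists k : {linear P -> Y (n + 1 + 1)},
      forall x, h x = diff Y (n + 1) (k x)) -> hom_exact P Y.
Proof.
move=> hP n h; split=> [|[k hk] x]; first exact: hP.
by rewrite hk diffK.
Qed.

Lemma hom_exact_retract P N Y (i : {linear N -> P}) (p : {linear P -> N}) :
  cancel i p -> hom_exact P Y -> hom_exact N Y.
Proof.
move=> ip PY; apply: hom_exactI => n h dh.
have [|k hk] := (PY n (h \o p)).1; first by move=> x; exact: dh.
by exists (k \o i) => x; rewrite -[x in LHS]ip; exact: hk.
Qed.

Lemma hom_exact_coprod (I : choiceType) (F : I -> lmodType R) Y :
  (forall i, hom_exact (F i) Y) -> hom_exact (coprod F) Y.
Proof.
move=> FY; apply: hom_exactI => n h dh.
have lift i : exists k : {linear F i -> Y (n + 1 + 1)},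
    forall x, h (coprod_in F i x) = diff Y (n + 1) (k x).
  by apply: (FY i n (h \o coprod_in F i)).1 => x; exact: dh.
pose k i := projT1 (cid (lift i)).
exists (coprod_elim k).
apply: (@coprod_ext _ _ _ _ h (diff Y (n + 1) \o coprod_elim k)) => i x.
apply: etrans (projT2 (cid (lift i)) x) _.
exact: (congr1 (diff Y (n + 1)) (esym (coprod_elim_in k x))).
Qed.

(** Finitely presented modules are pure projective by definition of pure
    exactness, and pure projectivity passes to coproducts and retracts. *)
Lemma pure_projective_Add (A : lmodType R -> Prop) X :
  (forall S, A S -> finitely_presented S) -> Add_class A X ->
  pure_projective X.
Proof.
move=> fpA /Add_class_data[[I F AF i p ip] _] Y pY.
apply: (hom_exact_retract ip); apply: hom_exact_coprod => j.
exact/pY/fpA/AF.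
Qed.

Lemma pure_projective_zero X : (forall x : X, x = 0) -> pure_projective X.
Proof.
move=> X0 Y _; apply: hom_exactI => n h _.
exists \0 => x; rewrite (X0 x) !linear0; reflexivity.
Qed.

End HomExact.

(** * Contractibility of pure exact complexes *)

Lemma add_sub_subK (V : zmodType) (a b x : V) : a + (x - a - b) + b = x.
Proof. by rewrite -addrA subrK addrC subrK. Qed.

Section Contraction.
Variable R : pzRingType.
Implicit Types X Y : complex R.

(** One degree of a pair of chain maps [al] : X -> Y and [be] : Y -> X together
    with a homotopy from the identity of X to [be] \o [al]. The first two
    clauses keep of the chain map condition what the next degree needs, so that
    the maps can be built one degree at a time by induction. *)
Definition comparison X Y (n k : int) :=
  exists (al : {linear X (n + 1) -> Y (k + 1)})
         (be : {linear Y (k + 1) -> X (n + 1)})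
         (s : {linear X (n + 1) -> X (n + 1 + 1)})
         (t : {linear X n -> X (n + 1)}),
    [/\ forall x, diff Y k (al (diff X (n + 1) x)) = 0,
        forall y, diff X n (be (diff Y (k + 1) y)) = 0 &
        forall x, x = be (al x) + diff X (n + 1) (s x) + t (diff X n x)].

Lemma comparison_step X Y n k :
  hom_exact (X (n + 1 + 1)) X -> hom_exact (X (n + 1 + 1)) Y ->
  hom_exact (Y (k + 1 + 1)) X ->
  comparison X Y n k -> comparison X Y (n + 1) (k + 1).
Proof.
move=> XX XY YX [al [be [s [t [dal dbe hst]]]]].
have [/(_ dal)[al' al'E] _] := XY k (al \o diff X (n + 1)).
have [/(_ dbe)[be' be'E] _] := YX n (be \o diff Y (k + 1)).
pose h := (idfun \- (be' \o al')) \- (s \o diff X (n + 1)).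
have [|s' s'E] := (XX (n + 1) h).1.
  move=> x; rewrite /= !linearB /= -be'E /= -al'E /=.
  by rewrite {1}[diff X (n + 1) x]hst diffK linear0 addr0 addrAC addrK subrr.
exists al', be', s', s; split=> [x|y|x].
- by rewrite -al'E /= diffK linear0.
- by rewrite -be'E /= diffK linear0.
- by rewrite -s'E /= add_sub_subK.
Qed.

(** Y is a resolution of the cycles of X in degree n + 1, so Y 0 covers the same
    module as X (n + 1 + 1); the homotopy starts with zero. *)
Lemma comparison_base X Y n :
  (forall k, hom_exact (X k) X) -> (forall k, hom_exact (X k) Y) ->
  hom_exact (Y 0) X -> (forall y : Y (-2), y = 0) ->
  lmod_iso (Y (-1)) (submod (kernel (diff X n))) ->
  comparison X Y (n + 1) (-1).
Proof.
move=> XX XY YX Y0 /lmod_iso_inverse[th [th' [thK th'K]]].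
have kd x : diff X (n + 1) x \in submodule_mem (kernel (diff X n)).
  by rewrite unfold_in; apply/eqP; exact: diffK.
have [c cE] := corestrict kd; pose i := sub_incl (kernel (diff X n)).
have [|al alE] := (XY (n + 1 + 1) (-2) (th' \o c)).1.
  by move=> x; exact: Y0.
have [|be beE] := (YX n (i \o (th \o diff Y (-1)))).1.
  by move=> y; exact: kernel_incl.
have [|s sE] := (XX (n + 1 + 1) (n + 1) (idfun \- (be \o al))).1.
  move=> x; rewrite /= linearB /= -[X in _ - X]beE /=.
  have -> : diff Y (-1) (al x) = th' (c x) by apply/esym; exact: alE.
  by rewrite th'K; apply/eqP; rewrite subr_eq0; apply/eqP/esym; exact: cE.
exists al, be, s, \0; split=> [x|y|x].
- have <- : th' (c (diff X (n + 1 + 1) x)) = diff Y (-1) (al (diff X _ x)).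
    exact: alE.
  suff -> : c (diff X (n + 1 + 1) x) = 0 by rewrite linear0.
  by apply: sub_incl_inj; rewrite cE diffK linear0.
- rewrite -beE /=.
  have -> : diff Y (-1) (diff Y (-1 + 1) y) = 0 by exact: diffK.
  by rewrite !linear0.
- rewrite -sE /= -[LHS](add_sub_subK (be (al x)) 0) subr0; reflexivity.
Qed.

(** Resolve the cycles of X in a degree so low that degree n + 1 of X is
    compared with degree d + 1 of the resolution, where the latter is zero: the
    identity of X (n + 1) is then homotopic to a map that factors through 0. *)
Lemma pure_exact_locally_contractible X :
  pure_exact X -> (forall n, pure_projective (X n)) ->
  finite_left_pure_gldim R ->
  forall n, exists (s : {linear X (n + 1) -> X (n + 1 + 1)})
                   (t : {linear X n -> X (n + 1)}),
    forall x, x = diff X (n + 1) (s x) + t (diff X n x).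
Proof.
move=> pX ppX [d gld] n.
pose m : int := n - d.+1%:Z - 1.
have [Y [pY Ym1 ppY Y0]] := gld (submod (kernel (diff X m))).
have ppY' (i : nat) : pure_projective (Y i%:Z).
  have [/ppY//|di] := leqP i d.
  by apply: pure_projective_zero; apply: Y0; right.
have comp (i : nat) : comparison X Y (m + 1 + i%:Z) (-1 + i%:Z).
  elim: i => [|i IHi].
    rewrite !addr0; apply: comparison_base => //.
    - by move=> k; exact: ppX.
    - by move=> k; exact: ppX.
    - exact: (ppY' 0%N).
    - by apply: Y0; left.
  have -> : m + 1 + i.+1%:Z = m + 1 + i%:Z + 1 by rewrite -addn1 PoszD addrA.
  have -> : -1 + i.+1%:Z = -1 + i%:Z + 1 by rewrite -addn1 PoszD addrA.
  apply: comparison_step => //; try exact: ppX.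
  have -> : -1 + i%:Z + 1 + 1 = i.+1%:Z :> int.
    by rewrite [-1 + _]addrC subrK -addn1 PoszD.
  exact: ppY'.
have := comp d.+1.
have -> : m + 1 + d.+1%:Z = n by rewrite /m subrK subrK.
case=> al [be [s [t [_ _ hst]]]]; exists s, t => x.
rewrite {1}[x]hst (_ : al x = 0) ?linear0 ?add0r //.
have Y0' k : k = d.+1%:Z -> forall y : Y k, y = 0.
  by move=> -> y; apply: Y0; right; exact: ltnSn.
by apply: Y0'; rewrite [-1 + _]addrC subrK.
Qed.

(** Every integer has the form n + 1; the transport along m - 1 + 1 = m is confined
    to this lemma. *)
Lemma extend_shifted (T : int -> Type) (u : forall n, T (n + 1)) :
  exists S : forall m, T m, forall n, S (n + 1) = u n.
Proof.
exists (fun m => ecast z (T z) (subrK 1 m) (u (m - 1))) => n.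
have: n + 1 - 1 = n by exact: addrK.
move: (subrK 1 (n + 1)); rewrite /=.
move: (n + 1 - 1) => k e kn; rewrite kn in e *.
by rewrite (eq_axiomK e).
Qed.

(** The homotopies found degree by degree need not fit together. They do give maps
    t with d t d = d, and then t (1 - t d) is a global contraction. *)
Lemma pure_exact_contractible X :
  pure_exact X -> (forall n, pure_projective (X n)) ->
  finite_left_pure_gldim R -> null_homotopic (cm1 X).
Proof.
move=> pX ppX gld.
have loc := pure_exact_locally_contractible pX ppX gld.
have loc2 n : exists t : {linear X n -> X (n + 1)},
    (forall x, diff X n (t (diff X n x)) = diff X n x).
  have [s [t st]] := loc n; exists t => x.
  by rewrite [in RHS](st x) linearD diffK add0r.
pose t n := projT1 (cid (loc2 n)).
have dtd n x : diff X n (t n (diff X n x)) = diff X n x.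
  exact: (projT2 (cid (loc2 n))).
have exX n (x : X (n + 1)) : diff X n x = 0 -> exists y, x = diff X (n + 1) y.
  have [s [t' st]] := loc n => dx; exists (s x).
  by rewrite {1}[x]st dx linear0 addr0.
(* The term t d at X (n + 1) involves the differential out of that degree, so
   u is only available in degrees written as a successor. *)
pose u n : {linear X (n + 1) -> X (n + 1 + 1)} :=
  t (n + 1) \o (idfun \- (t n \o diff X n)).
have [S SE] := @extend_shifted (fun n => {linear X n -> X (n + 1)}) u.
have du n x : diff X (n + 1) (u n x) = x - t n (diff X n x).
  have [|y yE] := exX n (x - t n (diff X n x)).
    by rewrite linearB dtd subrr.
  by rewrite /= yE dtd.
have ud m x : S m (diff X m x) = t m (diff X m x).
  have {}ud n y : S (n + 1) (diff X (n + 1) y) = t (n + 1) (diff X (n + 1) y).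
    by rewrite SE /= diffK linear0 subr0.
  by move: x; rewrite -(subrK 1 m) => x; exact: ud.
by exists S => n x; rewrite ud SE du subrK.
Qed.

End Contraction.

(** * Coproducts of complexes *)

Section CoproductMaps.
Variables (R : pzRingType) (I : choiceType) (A B : I -> lmodType R).
Variable k : forall i, {linear A i -> B i}.

Fact coprod_map_fin (f : coprod A) : finite_set [set i | k i (f i) != 0].
Proof.
apply: (sub_finite_set _ (dsum_fin f)) => i /=.
by apply: contra_neq => ->; rewrite linear0.
Qed.

Fact coprod_map_linear :
  linear (fun f : coprod A => DSum (coprod_map_fin f) : coprod B).
Proof. by move=> a f g; apply: coprodP => i; exact: linearP. Qed.
Definition coprod_map : {linear coprod A -> coprod B} := lin coprod_map_linear.

Lemma coprod_map_in i x : coprod_map (coprod_in A i x) = coprod_in B i (k i x).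
Proof.
apply: coprodP => j; change (k j (coprod_in A i x j) = coprod_in B i (k i x) j).
have [<-|ij] := eqVneq i j; first by rewrite !coprod_in_eq.
by rewrite !coprod_in_neq // linear0.
Qed.

End CoproductMaps.

Section CoproductComplex.
Variables (R : pzRingType) (I : choiceType) (X : I -> complex R).

Fact coprod_diffK n (f : coprod (fun i => X i (n + 1 + 1))) :
  coprod_map (fun i => diff (X i) n)
    (coprod_map (fun i => diff (X i) (n + 1)) f) = 0.
Proof. by apply: coprodP => i; exact: diffK. Qed.

Definition coprod_complex : complex R :=
  @Complex R (fun n => coprod (fun i => X i n)) _ coprod_diffK.

Fact coprod_inj_diff i n (x : X i (n + 1)) :
  coprod_in (fun j => X j n) i (diff (X i) n x) =
  diff coprod_complex n (coprod_in (fun j => X j (n + 1)) i x).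
Proof. by rewrite /= [RHS]coprod_map_in. Qed.
Definition coprod_inj i : chain_map (X i) coprod_complex :=
  @ChainMap R (X i) coprod_complex (fun n => coprod_in (fun j => X j n) i)
    (@coprod_inj_diff i).

Fact coprod_prj_diff i n (f : coprod_complex (n + 1)) :
  coprod_proj (fun j => X j n) i (diff coprod_complex n f) =
  diff (X i) n (coprod_proj (fun j => X j (n + 1)) i f).
Proof. by []. Qed.
Definition coprod_prj i : chain_map coprod_complex (X i) :=
  @ChainMap R coprod_complex (X i) (fun n => coprod_proj (fun j => X j n) i)
    (@coprod_prj_diff i).

(** Homotopies are families of linear maps without further conditions, so those on
    the summands assemble. *)
Lemma null_homotopic_coprod Y (f : chain_map coprod_complex Y) :
  (forall i, null_homotopic (cmM f (coprod_inj i))) -> null_homotopic f.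
Proof.
move=> nf; pose s i := projT1 (cid (nf i)).
have sE i n x : f (n + 1) (coprod_in _ i x) =
    diff Y (n + 1) (s i (n + 1) x) + s i n (diff (X i) n x).
  exact: (projT2 (cid (nf i))).
pose S n : {linear coprod_complex n -> Y (n + 1)} :=
  coprod_elim (fun i => s i n).
have SE n i x : S n (coprod_in _ i x) = s i n x by exact: coprod_elim_in.
exists S => n.
apply: (@coprod_ext _ _ _ _ (f (n + 1))
  ((diff Y (n + 1) \o S (n + 1)) \+ (S n \o diff coprod_complex n))) => i x.
rewrite sE -SE -[s i n _]SE coprod_inj_diff; reflexivity.
Qed.

Lemma coprod_universal Y (g : forall i, khom (X i) Y) :
  exists! f : khom coprod_complex Y,
    forall i, kcomp f (\pi_(khom _ _) (coprod_inj i)) = g i.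
Proof.
pose h i := repr (g i).
have hd n x : coprod_elim (fun i => h i n) (diff coprod_complex n x) =
    diff Y n (coprod_elim (fun i => h i (n + 1)) x).
  move: x; apply: (@coprod_ext _ _ _ _
    (coprod_elim (fun i => h i n) \o diff coprod_complex n)
    (diff Y n \o coprod_elim (fun i => h i (n + 1)))) => i x.
  have dx : diff coprod_complex n (coprod_in _ i x) =
      coprod_in (fun j => X j n) i (diff (X i) n x).
    exact/esym/coprod_inj_diff.
  apply: etrans (congr1 (coprod_elim (fun i => h i n)) dx) _.
  apply: etrans (coprod_elim_in _ _) _; rewrite cmap_diff.
  exact: (congr1 (diff Y n) (esym (coprod_elim_in (fun i => h i (n + 1)) x))).
pose H := @ChainMap R coprod_complex Y
  (fun n => coprod_elim (fun i => h i n)) hd.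
have hE i : kcomp (\pi_(khom _ _) H)
    (\pi_(khom _ _) (coprod_inj i)) = g i.
  rewrite kcompE -[RHS]reprK; congr (\pi_(khom _ _)).
  by apply: chain_mapP => n x; exact: coprod_elim_in.
exists (\pi_(khom _ _) H); split=> // f fE.
elim/khom_ind: f fE => f fE; apply/khomP/null_homotopic_coprod => i.
have /khomP[s sE] : \pi_(khom (X i) Y) (cmM H (coprod_inj i)) =
    \pi_(khom (X i) Y) (cmM f (coprod_inj i)).
  by rewrite -!kcompE hE fE.
by exists s.
Qed.

End CoproductComplex.

(** * Compact objects of the homotopy category *)

Section Compactness.
Variable R : pzRingType.

(** Every chain map from G to a coproduct of complexes has image in finitely many
    summands, uniformly in the degree. *)
Definition small (G : complex R) :=
  forall (I : choiceType) (X : I -> complex R)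
         (u : chain_map G (coprod_complex X)),
    exists2 s : seq I, uniq s &
      forall n (x : G n) i, i \notin s -> (u n x : coprod _) i = 0.

Lemma khom0 (X Y : complex R) : \pi_(khom X Y) 0 = 0.
Proof. by rewrite !piE. Qed.

Lemma khom_sum (X Y : complex R) (I : Type) (s : seq I)
    (f : I -> chain_map X Y) :
  \pi_(khom X Y) (\sum_(i <- s) f i) = \sum_(i <- s) \pi_(khom X Y) (f i).
Proof.
apply: big_morph; last exact: khom0.
by move=> g h; rewrite khomD.
Qed.

Lemma chain_map_sum (X Y : complex R) (I : Type) (s : seq I)
    (f : I -> chain_map X Y) n x :
  (\sum_(i <- s) f i) n x = \sum_(i <- s) f i n x.
Proof. exact: (big_morph (fun g : chain_map X Y => g n x)). Qed.

(** Already at the level of chain maps, a map with image in finitely many summands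
    is the sum of its components. *)
Lemma small_coprod (G : complex R) (I : choiceType) (X : I -> complex R)
    (w : khom G (coprod_complex X)) : small G ->
  exists s : seq I, [/\ uniq s,
    forall i, i \notin s -> kcomp (\pi_(khom _ _) (coprod_prj X i)) w = 0 &
    w = \sum_(i <- s) kcomp (\pi_(khom _ _) (coprod_inj X i))
                        (kcomp (\pi_(khom _ _) (coprod_prj X i)) w)].
Proof.
elim/khom_ind: w => w sG; have [s us ws] := sG I X w.
exists s; split=> // [i is_|].
  rewrite kcompE -khom0; congr (\pi_(khom _ _)); apply: chain_mapP => n x.
  exact: ws.
under eq_bigr => i _ do rewrite !kcompE.
rewrite -khom_sum; congr (\pi_(khom _ _)); apply: chain_mapP => n x.
by rewrite chain_map_sum; apply: coprod_sum_in => // i; exact: ws.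
Qed.

Lemma coprod_prj_inj (I : choiceType) (X : I -> complex R) i :
  kcomp (\pi_(khom _ _) (coprod_prj X i)) (\pi_(khom _ _) (coprod_inj X i)) =
  \pi_(khom (X i) (X i)) (cm1 (X i)).
Proof.
rewrite kcompE; congr (\pi_(khom _ _)); apply: chain_mapP => n x.
exact: (@coprod_in_eq _ _ (fun j => X j n)).
Qed.

Lemma coprod_prj_inj_neq (I : choiceType) (X : I -> complex R) i j : j != i ->
  kcomp (\pi_(khom _ _) (coprod_prj X i)) (\pi_(khom _ _) (coprod_inj X j)) = 0.
Proof.
move=> ji; rewrite kcompE -khom0; congr (\pi_(khom _ _)).
by apply: chain_mapP => n x; exact: (@coprod_in_neq _ _ (fun j => X j n)).
Qed.

End Compactness.

Section Preadditive.
Variable C : preadditive.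

Lemma comp_0r (X Y Z : C) (g : hom Y Z) : comp g (0 : hom X Y) = 0.
Proof. by apply: (addrI (comp g 0)); rewrite -compDr !addr0. Qed.

Lemma comp_0l (X Y Z : C) (f : hom X Y) : comp (0 : hom Y Z) f = 0.
Proof. by apply: (addrI (comp 0 f)); rewrite -compDl !addr0. Qed.

Lemma comp_sumr (X Y Z : C) (g : hom Y Z) (I : Type) (s : seq I)
    (f : I -> hom X Y) :
  comp g (\sum_(i <- s) f i) = \sum_(i <- s) comp g (f i).
Proof.
apply: (big_morph (fun f => comp g f)); last exact: comp_0r.
by move=> f1 f2; exact: compDr.
Qed.

Section CoproductMap.
Variables (K S : C) (I : choiceType) (X : I -> C) (inj : forall i, hom (X i) S).

Lemma hom_dsum_map_seq (f : dsum (fun i => hom K (X i))) (s : seq I) :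
  uniq s -> (forall i, i \notin s -> f i = 0) ->
  \sum_(i \in [set: I]) comp (inj i) (f i) =
  \sum_(i <- s) comp (inj i) (f i) :> hom K S.
Proof.
move=> us fs; rewrite (fsbigE s) //.
  by apply: eq_bigl => i; rewrite in_setT.
by move=> i _ /fs->; exact: comp_0r.
Qed.

(** A map into S that is the sum of finitely many components comes from the direct
    sum of the hom groups; the projections recover the components. *)
Lemma coproduct_map_bij (prj : forall i, hom S (X i)) :
  (forall i, comp (prj i) (inj i) = idm (X i)) ->
  (forall i j, j != i -> comp (prj i) (inj j) = 0) ->
  (forall w : hom K S, exists s : seq I, [/\ uniq s,
     forall i, i \notin s -> comp (prj i) w = 0 &
     w = \sum_(i <- s) comp (inj i) (comp (prj i) w)]) ->
  bijective (fun f : dsum (fun i => hom K (X i)) =>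
               (\sum_(i \in [set: I]) comp (inj i) (f i) : hom K S)).
Proof.
move=> prj_inj prj_inj0 dec.
pose phi (f : dsum (fun i => hom K (X i))) : hom K S :=
  \sum_(i \in [set: I]) comp (inj i) (f i).
change (bijective phi).
have prj_phi f i : comp (prj i) (phi f) = f i.
  have [s us fs] := dsum_support f; rewrite /phi (hom_dsum_map_seq us fs).
  rewrite comp_sumr.
  under eq_bigr => j _ do rewrite compA.
  have [is_|is_] := boolP (i \in s); last first.
    rewrite fs // big_seq big1 // => j js; rewrite prj_inj0 ?comp_0l //.
    by apply: contraNneq is_ => <-.
  rewrite (bigD1_seq i) //= prj_inj comp1m big1 ?addr0 // => j ji.
  by rewrite prj_inj0 ?comp_0l.
have phi_surj w : exists f, phi f = w.
  have [s [us w0 wE]] := dec w.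
  have fin : finite_set [set i | comp (prj i) w != 0].
    apply: (sub_finite_set _ (finite_seq s)) => i /=.
    by apply: contraR => /w0->.
  exists (DSum fin); rewrite [RHS]wE /phi.
  exact: (@hom_dsum_map_seq (DSum fin) s us w0).
have [psi psiK] := choice phi_surj.
exists psi => // f; apply: dsumP => i.
by rewrite -!prj_phi psiK.
Qed.

End CoproductMap.

(** Any two coproducts of a family are isomorphic, compatibly with the injections;
    compactness thus needs to be tested on one coproduct only. *)
Lemma coproduct_map_transfer (K S S' : C) (I : choiceType) (X : I -> C)
    (inj : forall i, hom (X i) S) (inj' : forall i, hom (X i) S') :
  is_coproduct inj -> is_coproduct inj' ->
  bijective (fun f : dsum (fun i => hom K (X i)) =>
               (\sum_(i \in [set: I]) comp (inj i) (f i) : hom K S)) ->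
  bijective (fun f : dsum (fun i => hom K (X i)) =>
               (\sum_(i \in [set: I]) comp (inj' i) (f i) : hom K S')).
Proof.
move=> cS cS' bij.
have [u [uE _]] := cS _ inj'; have [v [vE _]] := cS' _ inj.
have vu : comp v u = idm S.
  have [w [_ wu]] := cS _ inj; rewrite -(wu (comp v u)) => [|i].
    by apply: wu => i; rewrite comp1m.
  by rewrite -compA uE vE.
have uv : comp u v = idm S'.
  have [w [_ wu]] := cS' _ inj'; rewrite -(wu (comp u v)) => [|i].
    by apply: wu => i; rewrite comp1m.
  by rewrite -compA vE uE.
have bu : bijective (fun g : hom K S => comp u g).
  by exists (fun g => comp v g) => g; rewrite compA ?vu ?uv comp1m.
apply: (eq_bij (bij_comp bu bij)) => f /=.
have [s us fs] := dsum_support f.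
rewrite !(hom_dsum_map_seq _ us fs) comp_sumr.
by apply: eq_bigr => i _; rewrite compA uE.
Qed.

End Preadditive.

Section HomotopyCategory.
Variables (R : pzRingType) (A : lmodType R -> Prop).
Local Notation KA := (K (Add_class A)).

Definition K_coprod (I : choiceType) (X : I -> KA) : KA :=
  ComplexIn (complex_of := coprod_complex X)
    (fun n => Add_class_coprod (fun i => complex_inP (X i) n)).

Lemma K_coprodP (I : choiceType) (X : I -> KA) :
  @is_coproduct KA I X (K_coprod X)
    (fun i => \pi_(khom (X i) (K_coprod X)) (coprod_inj X i)).
Proof. by move=> Y f; exact: coprod_universal. Qed.

Lemma K_has_coproducts : has_coproducts KA.
Proof. by move=> I X; exists (K_coprod X); eexists; exact: K_coprodP. Qed.

Lemma small_compact (G : KA) : small G -> compact G.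
Proof.
move=> sG I X S inj cS.
refine (@coproduct_map_transfer KA G _ S I X _ inj (@K_coprodP I X) cS _).
apply: (@coproduct_map_bij KA G (K_coprod X) I X _
  (fun i => \pi_(khom (K_coprod X) (X i)) (coprod_prj X i))).
- exact: coprod_prj_inj.
- exact: coprod_prj_inj_neq.
- by move=> w; exact: small_coprod.
Qed.

End HomotopyCategory.

(** * Stalk complexes *)

Section Stalks.
Variables (R : pzRingType) (S : lmodType R).

Fact stalk_closed (b : bool) : submod_closed (fun x : S => b || (x == 0)).
Proof.
case: b; split=> [|a x y] //; rewrite !unfold_in //= => /eqP-> /eqP->.
by rewrite scaler0 addr0.
Qed.
(** This submodule is S if [b] is true and 0 otherwise. The terms of the stalk
    complex are defined as submodules of S, rather than by cases between S and
    0, so that inclusion into S and cutting down from S need no transport. *)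
Definition stalk_sub b := Submodule (stalk_closed b).

Fact stalk_diffK (k n : int) (x : submod (stalk_sub (n + 1 + 1 == k))) :
  (\0 : {linear submod (stalk_sub (n + 1 == k)) -> submod (stalk_sub (n == k))})
    ((\0 : {linear submod (stalk_sub (n + 1 + 1 == k)) -> _}) x) = 0.
Proof. by []. Qed.

Definition stalk k : complex R :=
  @Complex R (fun n : int => submod (stalk_sub (n == k))) _ (@stalk_diffK k).

Definition stalk_out k n : {linear stalk k n -> S} := sub_incl _.
Arguments stalk_out {k n}.

Definition stalk_cut (b : bool) : {linear S -> S} :=
  if b then (idfun : {linear S -> S}) else (\0 : {linear S -> S}).

Lemma stalk_cutK b (x : submod (stalk_sub b)) :
  stalk_cut b (sub_incl _ x) = sub_incl _ x.
Proof.
by case: b x => // x; have := sub_incl_mem x; rewrite unfold_in => /eqP->.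
Qed.

Fact stalk_in_mem (k n : int) x :
  stalk_cut (n == k) x \in submodule_mem (stalk_sub (n == k)).
Proof. by rewrite unfold_in; case: (n == k) => //=; rewrite eqxx. Qed.

Definition stalk_in k n : {linear S -> stalk k n} :=
  projT1 (cid (corestrict (@stalk_in_mem k n))).

Lemma stalk_inK k n : cancel (@stalk_out k n) (@stalk_in k n).
Proof.
move=> x; apply: sub_incl_inj.
rewrite (projT2 (cid (corestrict (@stalk_in_mem k n)))).
exact: stalk_cutK.
Qed.

Lemma stalk_outK k : cancel (@stalk_in k k) (@stalk_out k k).
Proof.
move=> x; rewrite [LHS](projT2 (cid (corestrict (@stalk_in_mem k k)))).
by rewrite eqxx.
Qed.

Lemma stalk_zero k n (x : stalk k n) : n != k -> x = 0.
Proof.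
move=> nk; apply: sub_incl_inj; rewrite linear0.
by have /orP[nk'|/eqP] := sub_incl_mem x; first by rewrite nk' in nk.
Qed.

Lemma stalk_small k : finitely_generated S -> small (stalk k).
Proof.
move=> [n [g gsurj]] I X u.
pose y j : coprod (fun i => X i k) := u k (stalk_in k k (g (delta_mx 0 j))).
have /choice[s sE] j : exists s : seq I, forall i, i \notin s -> y j i = 0.
  by have [s _ sE] := dsum_support (y j); exists s.
exists (undup (flatten [seq s j | j <- enum 'I_n])); first exact: undup_uniq.
move=> m x i; rewrite mem_undup => is_.
have [mk|mk] := eqVneq m k; last first.
  by rewrite (stalk_zero x mk) linear0.
subst m; have [v vx] := gsurj (stalk_out x).
rewrite -[x]stalk_inK -vx (row_sum_delta v) !linear_sum.
rewrite -[LHS]/(coprod_proj (fun i => X i k) i _) linear_sum big1 // => j _.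
rewrite !linearZ; suff -> : coprod_proj (fun i => X i k) i (y j) = 0.
  exact: scaler0.
apply: sE; apply: contra is_ => is_; apply/flattenP; exists (s j) => //.
by apply/map_f; rewrite mem_enum.
Qed.

(** A cycle of Hom(S, X) in degree n + 1 is a chain map from the stalk complex. *)
Lemma stalk_map (X : complex R) n (h : {linear S -> X (n + 1)}) :
  (forall x, diff X n (h x) = 0) ->
  exists f : chain_map (stalk (n + 1)) X, forall x, f (n + 1) x = h (stalk_out x).
Proof.
move=> dh; pose f0 m : {linear stalk (n + 1) m -> X m} := \0.
pose f := dfwith f0 (h \o @stalk_out (n + 1) (n + 1)).
have fd m x : f m (diff (stalk (n + 1)) m x) = diff X m (f (m + 1) x).
  rewrite linear0; apply/esym; have [mn|mn] := eqVneq m n.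
    by subst m; rewrite /f dfwith_in; exact: dh.
  rewrite /f dfwith_out ?linear0 //.
  by rewrite eq_sym; apply: contra_neq mn => /addIr.
by exists (ChainMap fd) => x; rewrite /= /f dfwith_in.
Qed.

(** The differentials of a stalk complex vanish, so a null homotopy of the chain
    map of a cycle exhibits the cycle as a boundary. *)
Lemma stalk_hom_exact (X : complex R) :
  (forall k (f : chain_map (stalk k) X), null_homotopic f) -> hom_exact S X.
Proof.
move=> nullX; apply: hom_exactI => n h dh; have [f fh] := stalk_map dh.
have [s sE] := nullX _ f; exists (s (n + 1) \o stalk_in (n + 1) (n + 1)) => x.
by rewrite -[x in LHS](@stalk_outK (n + 1)) -fh sE linear0 addr0.
Qed.

Lemma Add_class_stalk (A : lmodType R -> Prop) k n : A S ->
  Add_class A (stalk k n).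
Proof.
by move=> AS; apply: (Add_class_retract (@stalk_inK k n)); exact: Add_class_base.
Qed.

End Stalks.

(** * A set of representatives for the finitely presented modules *)

Section Presentations.
Variable R : pzRingType.

(** The modules form a proper class, but the matrices presenting the finitely
    presented ones form a set. *)
Definition presentation := {d : nat * nat & 'M[R]_(d.1, d.2)}.

Definition presents (p : presentation) (S : lmodType R) :=
  exists2 g : {linear 'rV[R]_(tag p).2 -> S}, forall x, exists v, g v = x &
    forall v, g v = 0 <-> exists u, v = u *m tagged p.

Lemma finitely_presented_presents S : finitely_presented S ->
  exists p, presents p S.
Proof.
case=> m [n [f [g [gsurj kerg]]]].
exists (Tagged (fun d : nat * nat => 'M[R]_(d.1, d.2))
  (lin1_mx f : 'M_((m, n).1, (m, n).2))).
exists g => // v; rewrite kerg.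
by split=> -[u uE]; exists u; [rewrite mul_rV_lin1|rewrite uE mul_rV_lin1].
Qed.

Lemma presents_uniq p S S' : presents p S -> presents p S' ->
  exists (a : {linear S -> S'}) (b : {linear S' -> S}), cancel a b.
Proof.
move=> [g gsurj kerg] [g' g'surj kerg'].
have [|a aE] := @factor_surj _ _ _ _ g g' gsurj.
  by move=> v /kerg ?; apply/kerg'.
have [|b bE] := @factor_surj _ _ _ _ g' g g'surj.
  by move=> v /kerg' ?; apply/kerg.
by exists a, b => x; have [v <-] := gsurj x; rewrite aE bE.
Qed.

End Presentations.

(** Maps from N to the terms of X factor through q, so Hom(N, X) and Hom(S, X) are
    the same complex. *)
Lemma universal_quotient_hom_exact (R : pzRingType) (M N S : lmodType R)
    (q : {linear N -> S}) (X : complex R) :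
  (forall y, exists x, q x = y) ->
  (forall (f : {linear N -> M}) x, q x = 0 -> f x = 0) ->
  (forall n, Add_class (sub_class (add_class (eq M))) (X n)) ->
  hom_exact S X -> hom_exact N X.
Proof.
move=> qsurj kerq AX SX; apply: hom_exactI => n h dh.
have [|h' h'E] := @factor_surj _ _ _ _ q h qsurj.
  move=> x qx; apply: Add_sub_cogenerated (AX _) _ => f.
  exact: (kerq (f \o h)).
have [|k kE] := (SX n h').1.
  by move=> y; have [x <-] := qsurj y; rewrite h'E.
by exists (k \o q) => x; rewrite -h'E kE.
Qed.

Theorem mainTheorem8 (R : pzRingType) (M : bimodule R) :
  left_coherent R ->
  right_coherent R ->
  finite_left_pure_gldim R ->
  finitely_presented (left_module M) ->
  finitely_presented (right_module M) ->
  compactly_generated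
    (K (Add_class (sub_class (add_class (eq (left_module M)))))).
Proof.
move=> lcoh rcoh gld lfp rfp; split; first exact: K_has_coproducts.
set B := sub_class _; pose KA := K (Add_class B).
have Bfp S : B S -> finitely_presented S by case.
pose P (p : presentation R) := `[< exists2 S, B S & presents p S >].
pose S (p : {p | P p}) := projT1 (cid2 (asboolW (valP p))).
have BS p : B (S p) by rewrite /S; case: cid2.
have pS p : presents (val p) (S p) by rewrite /S; case: cid2.
pose G (j : {p | P p} * int) : KA := ComplexIn (complex_of := stalk (S j.1) j.2)
  (fun n => Add_class_stalk j.2 n (BS j.1)).
exists ({p | P p} * int)%type, G; split=> [j|X GX].
  apply: small_compact; apply: stalk_small.
  by have [_ [n [_ [g [gsurj _]]]]] := Bfp _ (BS j.1); exists n, g.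
have XB S' : B S' -> hom_exact S' X.
  move=> BS'; have [p pS'] := finitely_presented_presents (Bfp _ BS').
  have Pp : P p by apply/asboolP; exists S'.
  have [a [b ab]] := presents_uniq pS' (pS (exist _ p Pp)).
  apply: (hom_exact_retract ab); apply: stalk_hom_exact => k f.
  have : \pi_(khom _ _) f = \pi_(khom _ _) 0.
    by rewrite khom0; exact: (GX (exist _ p Pp, k)).
  by move/khomP; rewrite subr0.
have pX : pure_exact X.
  move=> N fpN; have [S' BS' [q qsurj kerq]] :=
    universal_quotient lcoh rcoh lfp rfp fpN.
  exact: universal_quotient_hom_exact qsurj kerq (@complex_inP _ _ X) (XB _ BS').
have ppX n : pure_projective (X n).
  exact: pure_projective_Add Bfp (complex_inP X n).
have idX : idm X = 0 :> hom X X.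
  have /khomP : null_homotopic (cm1 X - 0).
    by rewrite subr0; exact: pure_exact_contractible.
  by rewrite khom0.
exists X; split; last by exists (idm X), (idm X); rewrite comp1m.
by move=> Y; split=> f; [rewrite -[f]compm1 idX comp_0r|rewrite -[f]comp1m idX comp_0l].
Qed.
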